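(* If an ideal $\mathcal{I}$ on $\omega$ is $\omega$-diagonalizable by $\mathcal{I}^*$-universal sets, then $$\aleph_1\le\mathfrak{b}(\mathcal{I},\mathcal{I},\mathcal{I})\le\mathfrak{b}=\mathfrak{b}(\mathcal{I},\mathrm{Fin},\mathrm{Fin})=\mathfrak{b}(\mathcal{I},\mathcal{I},\mathrm{Fin}).$$
   Context: An ideal on $\omega$ is a family $\mathcal{I}\subseteq\mathcal{P}(\omega)$ closed under finite unions and subsets, containing all finite sets, with $\omega\notin\mathcal{I}$; $\mathrm{Fin}$ is the ideal of finite sets; $\mathcal{I}^*=\{A:\omega\setminus A\in\mathcal{I}\}$. A family $\mathcal{Z}$ of nonempty finite subsets of $\omega$ is $\mathcal{I}^*$-universal if for each $F\in\mathcal{I}^*$ there is $Z\in\mathcal{Z}$ with $Z\subseteq F$. $\mathcal{I}$ is $\omega$-diagonalizable by $\mathcal{I}^*$-universal sets if there are $\mathcal{I}^*$-universal families $\mathcal{Z}_k$, $k\in\omega$, such that for each $F\in\mathcal{I}^*$ there is $k$ with $Z\cap F\ne\emptyset$ for every $Z\in\mathcal{Z}_k$. $\mathfrak{b}$ is the bounding number. For an ideal $\mathcal{K}$, $\widehat{\mathcal{P}}_{\mathcal{K}}$ is the family of sequences $\langle A_n\rangle$ of pairwise disjoint members of $\mathcal{K}$, and $\mathcal{P}_{\mathcal{K}}$ those with union $\omega$. $\mathfrak{b}(\mathcal{I},\mathcal{J},\mathcal{K})=\min\{|\mathcal{E}|:\mathcal{E}\subseteq\widehat{\mathcal{P}}_{\mathcal{K}},\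 \forall\langle A_n\rangle\in\mathcal{P}_{\mathcal{J}}\ \exists\langle E_n\rangle\in\mathcal{E}\ \bigcup_n(A_n\cap\bigcup_{i\le n}E_i)\notin\mathcal{I}\}$, with $\min\emptyset=\mathfrak{c}^+$. *)

(* Defs.v *)
From mathcomp Require Import all_boot.
From mathcomp Require Import boolp classical_sets functions cardinality.

Set Implicit Arguments.
Unset Strict Implicit.
Unset Printing Implicit Defensive.

Local Open Scope classical_set_scope.
Local Open Scope card_scope.

(* Cardinal numbers are represented by sets, compared with [#<=] and [#=].
   The minimum of a class of cardinals is represented by a set of the class
   that has least cardinality; [min_cardP] shows that it exists whenever the
   class is nonempty (the junk value on the empty class is [set0]). *)
Definition min_card (T : Type) (P : set (set T)) : set T :=
  xget set0 [set A | P A /\ forall B, P B -> A #<= B].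

Lemma min_cardP (T : Type) (P : set (set T)) : P !=set0 ->
  P (min_card P) /\ forall B, P B -> min_card P #<= B.
Proof.
move=> [A0 PA0].
suff : exists A, P A /\ forall B, P B -> A #<= B.
  exact: (@xgetPex _ set0 [set A | P A /\ forall B, P B -> A #<= B]).
pose sep (X : set (set T -> T)) :=
  (forall s, X s -> forall B, P B -> B (s B)) /\
  (forall s t B, X s -> X t -> P B -> s B = t B -> s = t).
have [F sepF totF|X [[Xin Xinj] Xmax]] := @Zorn_bigcup _ sep.
  split=> [s [Y FY Ys] B PB|s t B [Y FY Ys] [Z FZ Zt] PB st].
    by have [inY _] := sepF _ FY; exact: (inY s Ys B PB).
  have [YZ|ZY] := totF _ _ FY FZ.
    by have [_ sepZ] := sepF _ FZ; apply: (sepZ s t B) => //; exact: YZ.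
  by have [_ sepY] := sepF _ FY; apply: (sepY s t B) => //; exact: ZY.
have [A PA XA] : exists2 A, P A & forall a, A a -> exists2 s, X s & s A = a.
  apply: contrapT => noA.
  have miss B : P B -> exists2 b, B b & forall s, X s -> s B <> b.
    move=> PB; apply: contrapT => nob; apply: noA; exists B => // b Bb.
    apply: contrapT => nos; apply: nob; exists b => // s Xs sB.
    by apply: nos; exists s.
  have [a0 _ _] := miss _ PA0.
  have [s sP] : {s : set T -> T &
      forall B, P B -> B (s B) /\ forall t, X t -> t B <> s B}.
    apply: (@choice _ _ (fun B b => P B -> B b /\ forall t, X t -> t B <> b)).
    move=> B; have [PB|nPB] := pselect (P B); last by exists a0.
    by have [b Bb bP] := miss _ PB; exists b.
  have nXs : ~ X s by move=> Xs; have [_ /(_ _ Xs)] := sP _ PA0.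
  apply: (Xmax (X `|` [set s])).
    by split=> [|XsX]; [left | apply/nXs/XsX; right].
  split; first by move=> t [/Xin//|->] B PB; have [] := sP _ PB.
  move=> t u B [Xt|->] [Xu|->] PB // e; first exact: Xinj e.
    by have [_ /(_ _ Xt)] := sP _ PB.
  by have [_ /(_ _ Xu)] := sP _ PB; rewrite e.
exists A; split=> // B PB.
have [f fP] : {f : T -> set T -> T & forall a, A a -> X (f a) /\ f a A = a}.
  apply: (@choice _ _ (fun a s => A a -> X s /\ s A = a)) => a.
  have [Aa|nAa] := pselect (A a); last by exists (fun=> a).
  by have [s] := XA _ Aa; exists s.
suff [g] : $|{injfun A >-> B}| by exact: inj_card_le g.
apply/injfunPex; exists (fun a => f a B) => [a Aa|a b /set_mem Aa /set_mem Ab e].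
  by have [Xfa _] := fP _ Aa; exact: (Xin _ Xfa _ PB).
have [Xa <-] := fP _ Aa; have [Xb <-] := fP _ Ab.
by rewrite (Xinj _ _ _ Xa Xb PB e).
Qed.

(* The successor cardinal of (the cardinal of) T: the least cardinal that does
   not embed in T. By Cantor's theorem it can be looked for among the subsets
   of the powerset of T. *)
Definition succ_card (T : Type) : set (set T) :=
  min_card [set A : set (set T) | ~ (A #<= [set: T])].
Arguments succ_card T : clear implicits.

Lemma card_total (T U : Type) (A : set T) (B : set U) : A #<= B \/ B #<= A.
Proof.
have iA : @inl T U @` A #= A by apply: inj_card_eq => x y _ _ [].
have iB : @inr T U @` B #= B by apply: inj_card_eq => x y _ _ [].
have [|PM minM] :=
    @min_cardP (T + U)%type [set C | C = @inl T U @` A \/ C = @inr T U @` B].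
  by exists (@inl T U @` A); left.
have leA := minM _ (or_introl erefl); have leB := minM _ (or_intror erefl).
move: PM leA leB => /= -[->|->].
  by move=> _ leB; left; rewrite -(card_le_eql iA) -(card_le_eqr iB).
by move=> leA _; right; rewrite -(card_le_eql iB) -(card_le_eqr iA).
Qed.

Lemma succ_cardP (T : Type) : ~ (succ_card T #<= [set: T]) /\
  forall (U : Type) (B : set U), ~ (B #<= [set: T]) -> succ_card T #<= B.
Proof.
have cantor : ~ ([set: set T] #<= [set: T]).
  move=> /pcard_surjP[g gsurj].
  have [x _ gx] := gsurj [set x | ~ g x x] I.
  have : g x x <-> ~ g x x by rewrite {1}gx.
  tauto.
have [|ns mins] := @min_cardP _ [set A : set (set T) | ~ (A #<= [set: T])].
  by exists setT.
split=> // U B nB; have [BT|TB] := card_total B [set: set T].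
  have /pcard_leTP[f] := BT.
  have iB := card_image f.
  by rewrite -(card_le_eqr iB); apply: mins; rewrite /= (card_le_eql iB).
by apply: card_le_trans TB; apply: mins.
Qed.

Definition aleph1 : set (set nat) := succ_card nat.

Definition continuum_succ : set (set (set nat)) := succ_card (set nat).

(* min {|A| : P A}, with min of the empty class equal to c^+. The two cases
   are represented by sets on different types, hence the disjoint sum. *)
Definition min_card_or_csucc (T : Type) (P : set (set T)) :
    set (T + set (set nat)) :=
  if `[< P !=set0 >] then inl @` min_card P else inr @` continuum_succ.

Definition is_ideal (I : set (set nat)) : Prop :=
  [/\ forall A B, I A -> I B -> I (A `|` B),
      forall A B, I B -> A `<=` B -> I A,
      forall A, finite_set A -> I A &
      ~ I [set: nat]].

Definition Fin : set (set nat) := [set A | finite_set A].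

Definition dual_filter (I : set (set nat)) : set (set nat) :=
  [set A | I (~` A)].

Definition universal_family (I Z : set (set nat)) : Prop :=
  (forall z, Z z -> finite_set z /\ z !=set0) /\
  (forall F, dual_filter I F -> exists2 z, Z z & z `<=` F).

Definition omega_diagonalizable (I : set (set nat)) : Prop :=
  exists Z : nat -> set (set nat),
    (forall k, universal_family I (Z k)) /\
    (forall F, dual_filter I F ->
       exists k, forall z, Z k z -> z `&` F !=set0).

Definition Phat (K : set (set nat)) : set (nat -> set nat) :=
  [set A | (forall n, K (A n)) /\ trivIset [set: nat] A].

Definition Ppart (K : set (set nat)) : set (nat -> set nat) :=
  [set A | Phat K A /\ \bigcup_n A n = [set: nat]].

Definition ideal_b_family (I J K : set (set nat)) : set (set (nat -> set nat)) :=
  [set E | E `<=` Phat K /\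
     forall A, Ppart J A -> exists2 e, E e &
       ~ I (\bigcup_n (A n `&` \bigcup_(i in [set i | (i <= n)%N]) e i))].

Definition ideal_b (I J K : set (set nat)) :
    set ((nat -> set nat) + set (set nat)) :=
  min_card_or_csucc (ideal_b_family I J K).

Definition le_star (f g : nat -> nat) : Prop :=
  finite_set [set n | ~ (f n <= g n)%N].

Definition bounding_number : set (nat -> nat) :=
  min_card [set B : set (nat -> nat) |
    forall g, exists2 f, B f & ~ le_star f g].

(* Main.v *)
(** If [f_e n] bounds [\bigcup_(i <= n) e_i] and [g] eventually dominates
    [f_e], then cutting [nat] into finite sets [A_n], with [A_n] above [g n] for
    [n > 0], makes the diagonal union of [A] and [e] finite; hence
    [b <= b(I, Fin, Fin)].
    Conversely, an increasing [f] yields the intervals [e_i] between its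
    consecutive values, and for a partition [A] into members of [I] the
    universal families give a function [g] such that the interval below [g n]
    contains, for each [k <= n], a member of [Z_k] disjoint from the [A_i],
    [i < n].
    If [f] is not dominated by [g], the diagonal union of [A] and [e] contains a
    member of every [Z_k], so it is not in [I]; hence [b(I, I, Fin) <= b].
    Countably many sequences [e^j] never suffice for [b(I, I, I)]: take for
    [A_n] the differences of the increasing sets
    [D_n = \bigcup_(j < n) \bigcup_(i <= n) e^j_i], which all lie in [I]. *)
Require Import Defs.
From mathcomp Require Import all_boot.
From mathcomp Require Import boolp classical_sets functions cardinality.
Local Open Scope classical_set_scope.
Local Open Scope card_scope.

Local Notation diag_union A e :=
  (\bigcup_n (A n `&` \bigcup_(i in [set i | (i <= n)%N]) e i)).

Lemma finite_set_nat_ub (A : set nat) : finite_set A -> exists m, A `<=` `I_m.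
Proof.
move=> /finite_seqP[s ->]; exists (\max_(i <- s) i).+1 => x /= xs.
by rewrite ltnS; exact: (@leq_bigmax_seq _ s xpredT id).
Qed.

Lemma Fin_ideal : is_ideal Fin.
Proof.
split=> // [A B fA fB|A B fB AB|].
- by rewrite /Fin /= finite_setU.
- exact: sub_finite_set fB.
- exact: infinite_nat.
Qed.

Lemma ideal_bigcup_lt {J : set (set nat)} (e : nat -> set nat) m :
  is_ideal J -> (forall j, J (e j)) -> J (\bigcup_(j in `I_m) e j).
Proof.
move=> [JU Jsub Jfin _] Je; elim: m => [|m IH].
  by apply: Jfin; rewrite II0 bigcup_set0.
apply: Jsub (JU _ _ IH (Je m)) _ => x [j /=]; rewrite ltnS leq_eqVlt.
by case/orP=> [/eqP ->|jm] ejx; [right | left; exists j].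
Qed.

Lemma fibers_Ppart (J : set (set nat)) (h : nat -> nat) :
  (forall n, J (h @^-1` [set n])) -> Ppart J (fun n => h @^-1` [set n]).
Proof.
move=> Jh; split; last by apply/seteqP; split=> // x _; exists (h x).
by split=> // i j _ _ [x [/= <- <-]].
Qed.

(** Only the first [N] sets [A n] can contribute, and a finite union of members of [J] stays in
    [J]. *)
Lemma ideal_diag_union {J : set (set nat)} (A e : nat -> set nat) N :
  is_ideal J -> (forall n, J (A n)) ->
  (forall n i x, (N <= n)%N -> (i <= n)%N -> A n x -> ~ e i x) ->
  J (diag_union A e).
Proof.
move=> idJ JA disj; have [_ Jsub _ _] := idJ.
apply: Jsub (ideal_bigcup_lt A N idJ JA) _ => x [n _ [Anx [i /= lein eix]]].
by exists n => //=; rewrite ltnNge; apply/negP => leNn; exact: (disj n i x).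
Qed.

Lemma ideal_b_card {J K L : set (set nat)} {E} : ideal_b_family J K L E ->
  ideal_b J K L #= min_card (ideal_b_family J K L).
Proof.
move=> famE; rewrite /ideal_b /min_card_or_csucc asboolT; last by exists E.
by apply: inj_card_eq => x y _ _ [].
Qed.

Lemma ideal_b_le {J K L : set (set nat)} {E} : ideal_b_family J K L E ->
  ideal_b J K L #<= E.
Proof.
move=> famE; rewrite (card_le_eql (ideal_b_card famE)).
by have [|_] := @min_cardP _ (ideal_b_family J K L); [exists E | apply].
Qed.

Lemma ideal_b_attained {J K L : set (set nat)} {E} : ideal_b_family J K L E ->
  exists2 E', ideal_b_family J K L E' & E' #= ideal_b J K L.
Proof.
move=> famE; exists (min_card (ideal_b_family J K L)).
  by have [|] := @min_cardP _ (ideal_b_family J K L); first by exists E.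
by rewrite card_eq_sym; exact: ideal_b_card famE.
Qed.

Lemma ideal_b_familyS {J K K' L L' : set (set nat)} {E} :
  K' `<=` K -> L `<=` L' -> ideal_b_family J K L E -> ideal_b_family J K' L' E.
Proof.
move=> K'K LL' [EL famE]; split=> [e /EL[Le te]|A [[K'A tA] uA]].
  by split=> // n; exact/LL'.
by apply: famE; split=> //; split=> // n; exact/K'K.
Qed.

Lemma bounding_numberP :
  (forall g, exists2 f, bounding_number f & ~ le_star f g) /\
  forall B : set (nat -> nat), (forall g, exists2 f, B f & ~ le_star f g) ->
    bounding_number #<= B.
Proof.
apply: min_cardP; exists setT => g; exists (S \o g) => //.
by apply: sub_infinite_set infinite_nat => n _ /=; rewrite ltnn.
Qed.

(* [h x] is the largest [m <= x] with [g m <= x], if there is one. *)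
Lemma exists_slow_index (g : nat -> nat) : exists2 h : nat -> nat,
  forall n, finite_set (h @^-1` [set n]) &
  forall x, (0 < h x)%N -> (g (h x) <= x)%N.
Proof.
pose h x := \max_(m < x.+1 | (g m <= x)%N) m.
exists h => [n|x].
  (* Once [x] reaches both [n.+1] and [g n.+1], the index [n.+1] competes in the maximum, so [h x]
     exceeds [n]. *)
  apply: (@sub_finite_set _ _ `I_(maxn n.+1 (g n.+1))); last exact: finite_II.
  move=> x /= hx; rewrite ltnNge geq_max; apply/negP => /andP[nx gx].
  have := @leq_bigmax_cond _ (fun m : 'I_x.+1 => (g m <= x)%N) (@nat_of_ord _)
    (Ordinal (nx : n.+1 < x.+1)%N) gx.
  by rewrite -/(h x) hx /= ltnn.
by rewrite /h; elim/big_ind: _ => // m1 m2 IH1 IH2; rewrite /maxn; case: ifP.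
Qed.

Lemma bounding_number_le_family {J : set (set nat)} {E} : is_ideal J ->
  ideal_b_family J Fin Fin E -> bounding_number #<= E.
Proof.
move=> [_ _ Jfin _] [EF famE].
have [F FP] : {F : (nat -> set nat) -> nat -> nat & forall e, Phat Fin e ->
    forall n i, (i <= n)%N -> e i `<=` `I_(F e n)}.
  apply: (@choice _ _ (fun e f => Phat Fin e -> forall n i : nat, (i <= n)%N ->
    e i `<=` `I_(f n))) => e.
  have [[fe _]|ne] := pselect (Phat Fin e); last by exists id.
  have [f fP] : {f : nat -> nat & forall n, \bigcup_(i in `I_n.+1) e i `<=` `I_(f n)}.
    apply: (@choice _ _ (fun n m => \bigcup_(i in `I_n.+1) e i `<=` `I_m)) => n.
    exact/finite_set_nat_ub/(ideal_bigcup_lt e _ Fin_ideal).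
  by exists f => _ n i lein x eix; apply: fP; exists i.
apply: card_le_trans (card_image_le F E).
apply: bounding_numberP.2 => g.
have [h finh gh] := exists_slow_index g.
have [e Ee nJ] := famE _ (fibers_Ppart _ _ finh).
exists (F e); first by exists e.
move=> /finite_set_nat_ub[m ltm]; apply: nJ; apply: Jfin.
(* From [m] on, [g] dominates [F e]; the 1 is there because [gh] speaks only of positive values of
   [h]. *)
apply: (ideal_diag_union _ _ (maxn m 1) Fin_ideal finh) => n i x.
rewrite geq_max => /andP[mn n0] lein /= hx eix.
have Fg : (F e n <= g n)%N.
  by apply: contrapT => nFg; have := ltm _ nFg; rewrite /= ltnNge mn.
have := gh x; rewrite hx => /(_ n0); apply/negP; rewrite -ltnNge.
exact: leq_trans (FP _ (EF _ Ee) _ _ lein _ eix) Fg.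
Qed.

Definition running_max (f : nat -> nat) (n : nat) : nat := \max_(i < n.+1) f i.

Lemma leq_running_max f n : (f n <= running_max f n)%N.
Proof. exact: (@leq_bigmax _ (fun i : 'I_n.+1 => f i) ord_max). Qed.

Lemma running_max_homo f m n : (m <= n)%N -> (running_max f m <= running_max f n)%N.
Proof.
move=> lemn; apply/bigmax_leqP => i _.
exact: (@leq_bigmax _ (fun i : 'I_n.+1 => f i) (widen_ord (lemn : m < n.+1)%N i)).
Qed.

(** The running maximum stands in for an increasing [f]. Quantifying over all [j < n] lets the
    interval of index 0 start at 0 without a case distinction. *)
Definition max_intervals (f : nat -> nat) (n : nat) : set nat :=
  [set x | (x < running_max f n)%N /\ forall j, (j < n)%N -> (running_max f j <= x)%N].

Lemma max_intervals_Phat f : Phat Fin (max_intervals f).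
Proof.
split=> [n|i j _ _ [x [[xi ix] [xj jx]]]].
  by apply: sub_finite_set (finite_II (running_max f n)) => x [].
case: (ltngtP i j) => // [/jx|/ix]; first by rewrite leqNgt xi.
by rewrite leqNgt xj.
Qed.

Lemma sub_max_intervals f n :
  `I_(running_max f n) `<=` \bigcup_(i in [set i | (i <= n)%N]) max_intervals f i.
Proof.
move=> x /= xn; have ex : exists i, (x < running_max f i)%N by exists n.
case: (ex_minnP ex) => i xi mini; exists i; first exact: mini.
by split=> // j; rewrite leqNgt [(running_max f j <= x)%N]leqNgt; apply: contra => /mini.
Qed.

Lemma max_intervals_family {I : set (set nat)} {B : set (nat -> nat)} :
  is_ideal I -> omega_diagonalizable I ->
  (forall g, exists2 f, B f & ~ le_star f g) ->
  ideal_b_family I I Fin (max_intervals @` B).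
Proof.
move=> idI [Z [univZ diagZ]] unbB; split=> [_ [f _ <-]|A [[IA _] uA]].
  exact: max_intervals_Phat.
have [g gP] : {g : nat -> nat & forall n k, (k <= n)%N -> exists2 z, Z k z &
    z `<=` `I_(g n) `\` \bigcup_(i in `I_n) A i}.
  apply: (@choice _ _ (fun n m => forall k, (k <= n)%N -> exists2 z, Z k z &
    z `<=` `I_m `\` \bigcup_(i in `I_n) A i)) => n.
  have IAn : dual_filter I (~` \bigcup_(i in `I_n) A i).
    by rewrite /dual_filter /= setCK; exact: (ideal_bigcup_lt A).
  have [b bP] : {b : nat -> nat & forall k, exists2 z, Z k z &
      z `<=` `I_(b k) `\` \bigcup_(i in `I_n) A i}.
    apply: (@choice _ _ (fun k m => exists2 z, Z k z &
      z `<=` `I_m `\` \bigcup_(i in `I_n) A i)) => k.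
    have [finZ /(_ _ IAn)[z Zz zA]] := univZ k.
    have [m zm] := finite_set_nat_ub _ (finZ _ Zz).1.
    by exists m, z => // x zx; split; [exact: zm | exact: zA].
  exists (running_max b n) => k lekn; have [z Zz zP] := bP k.
  exists z => // x /zP[/= xk nAx]; split=> //=.
  apply: leq_trans xk _; apply: leq_trans (leq_running_max _ _) _.
  exact: running_max_homo.
have [f Bf nfg] := unbB g; exists (max_intervals f); first by exists f.
move=> IU.
(* Every member of this [Z k] meets the complement of the diagonal union, but any [n >= k] with
   [g n < f n] puts a member inside the union. *)
have [|k zk] := diagZ (~` diag_union A (max_intervals f)).
  by rewrite /dual_filter /= setCK.
apply: nfg; apply: sub_finite_set (finite_II k) => n /= /negP.
rewrite -ltnNge => gf; rewrite ltnNge; apply/negP => lekn.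
have [z Zz zP] := gP n k lekn.
have [x [zx]] := zk z Zz; apply.
have [/= xg nAx] := zP x zx.
(* Since [x] avoids [A i] for [i < n], its index [m] is at least [n], so [x] lies below
   [running_max f m]. *)
have [m _ Amx] : (\bigcup_n A n) x by rewrite uA.
exists m => //; split=> //; apply: sub_max_intervals => /=.
apply: leq_trans xg _; apply: leq_trans (ltnW gf) _.
apply: leq_trans (leq_running_max _ _) _; apply: running_max_homo.
by rewrite leqNgt; apply/negP => mn; apply: nAx; exists m.
Qed.

Lemma countable_not_family {J : set (set nat)} {E} : is_ideal J ->
  ideal_b_family J J J E -> ~ (E #<= [set: nat]).
Proof.
move=> idJ [EJ famE] /pcard_surjP[e surje].
have [JU Jsub Jfin _] := idJ.
(* The enumeration [e] may take values outside [E]; these contribute [set0], which keeps [D m] in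
   [J]. *)
pose G (m j : nat) : set nat :=
  if `[< E (e j) >] then \bigcup_(i in `I_m.+1) e j i else set0.
pose D m : set nat := \bigcup_(j in `I_m) G m j.
have JD m : J (D m).
  apply: (ideal_bigcup_lt (G m)) => // j; rewrite /G; case: asboolP => [|_].
    by move=> /EJ[Je _]; exact: (ideal_bigcup_lt (e j)).
  exact: Jfin.
have [h hP] : {h : nat -> nat & forall x,
    (D (h x).+1 x \/ x = h x) /\ forall m, D m x -> (h x < m)%N}.
  (* As [D 0] is empty, the least [m] with [D m x] is a successor, and [h x] is its predecessor. A
     point in no [D m] gets [h x = x], which adds at most one point to each fiber. *)
  apply: (@choice _ _ (fun x n => (D n.+1 x \/ x = n) /\
    forall m, D m x -> (n < m)%N)) => x.
  have [[m Dm]|nD] := pselect (exists m, D m x); last first.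
    by exists x; split=> [|m Dm]; [right | case: nD; exists m].
  have ex : exists m, `[< D m x >] by exists m; apply/asboolP.
  case: (ex_minnP ex) => -[/asboolP[//]|n /asboolP Dn minn].
  by exists n; split=> [|k Dk]; [left | apply: minn; apply/asboolP].
have Jh n : J (h @^-1` [set n]).
  apply: Jsub (JU _ _ (JD n.+1) (Jfin _ (finite_set1 n))) _ => x /= hx.
  by case: (hP x).1; rewrite hx; [left | right].
have [a /[dup] Ea /surje[j _ eja]] := famE _ (fibers_Ppart _ _ Jh); apply.
(* For [n > j], the set [D n] contains all [a i] with [i <= n], whereas the fiber over [n] misses
   [D n]. *)
apply: (ideal_diag_union _ _ j.+1 idJ Jh) => n i x jn lein /= hx aix.
suff : D n x by move=> /(hP x).2; rewrite hx ltnn.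
exists j => //.
by rewrite /G eja asboolT //; exists i.
Qed.

Theorem theorem6p7 (I : set (set nat)) (idealI : is_ideal I)
    (diagI : omega_diagonalizable I) :
  [/\ aleph1 #<= ideal_b I I I,
      ideal_b I I I #<= bounding_number,
      bounding_number #= ideal_b I Fin Fin &
      ideal_b I Fin Fin #= ideal_b I I Fin].
Proof.
have FinI : Fin `<=` I by have [_ _ Ifin _] := idealI.
(* The intervals of a least unbounded family show that all three classes are nonempty, so no minimum
   takes its default value. *)
have famIIF := max_intervals_family idealI diagI bounding_numberP.1.
have famIII := ideal_b_familyS (@subset_refl _ I) FinI famIIF.
have famIFF := ideal_b_familyS FinI (@subset_refl _ Fin) famIIF.
have le_b := card_image_le max_intervals bounding_number.
have b_le : bounding_number #<= ideal_b I Fin Fin.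
  have [E famE eqE] := ideal_b_attained famIFF.
  by rewrite -(card_le_eqr eqE); exact: bounding_number_le_family famE.
have bFF : bounding_number #= ideal_b I Fin Fin.
  apply: Cantor_Bernstein => //.
  exact: card_le_trans (ideal_b_le famIFF) le_b.
split=> //.
- apply: (succ_cardP nat).2; have [E famE eqE] := ideal_b_attained famIII.
  by rewrite -(card_le_eql eqE); exact: countable_not_family famE.
- exact: card_le_trans (ideal_b_le famIII) le_b.
- apply: Cantor_Bernstein.
    have [E famE eqE] := ideal_b_attained famIIF.
    rewrite -(card_le_eqr eqE); apply: ideal_b_le.
    exact: ideal_b_familyS FinI (@subset_refl _ Fin) famE.
  rewrite -(card_le_eqr bFF).
  exact: card_le_trans (ideal_b_le famIIF) le_b.
Qed.
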